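(* Let $\mathrm{BRO}(\mathcal{U})$ satisfying (BRO-1) and (BRO-3) be given, with a nonempty polytope explicitly stated as $\mathcal{U}=\{\xi\in\mathbb{R}^m: C\xi\le d\}$ for a matrix $C\in\mathbb{R}^{m'\times m}$ and a vector $d\in\mathbb{R}^{m'}$ as uncertainty set, and with bilinear functions $f_1,f_2:\mathcal{X}\times\mathcal{U}\to\mathbb{R}$. Then the multiobjective optimizer's approach with dualization (DA) solves $\mathrm{BRO}(\mathcal{U})$, i.e. it returns a representative set $X^\ast$ of extreme supported efficient solutions and the set $Y^\ast$ of extreme supported nondominated points of $\mathrm{BRO}(\mathcal{U})$.
   Context: Orders: for $y,\bar y\in\mathbb{R}^p$, $\le$ is componentwise; $y\preceq\bar y$ ($y$ dominates $\bar y$) means $y\le\bar y$ and $y\ne\bar y$. Problem: $\mathrm{BRO}(\mathcal{U})$ is the problem $\min_{x\in\mathcal{X}} f^{\mathcal{U}}(x)$ with $f^{\mathcal{U}}=(f_1^{\mathcal{U}},f_2^{\mathcal{U}})^t$, $f_i^{\mathcal{U}}(x)=\sup_{\xi\in\mathcal{U}}f_i(x,\xi)$. (BRO-1): $\mathcal{X}=P\cap(\mathbb{Z}^k\times\mathbb{R}^{n-k})$ (nonempty) with $P\subseteq\mathbb{R}^n$ a polytope and $0\le k\le n$. (BRO-3): $f_1,f_2$ are linear in $x$ for every fixed $\xi\in\mathcal{U}$, and quasi-convex and continuous in $\xi$ for every fixed $x\in\mathcal{X}$. Bilinear: $f_i$ is linear in $x$ for every fixed $\xi$ and linear in $\xi$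 for every fixed $x$; write $f_i(x,\xi)=[\hat c_i(x)]^t\xi$ with $\hat c_i:\mathcal{X}\to\mathbb{R}^m$. Solutions: for $\min_{x\in\mathcal{X}}g(x)$ with $\mathcal{Y}=g(\mathcal{X})$, $x\in\mathcal{X}$ is efficient and $g(x)$ nondominated if no $x'\in\mathcal{X}\setminus\{x\}$ has $g(x')\preceq g(x)$. A point $y\in\mathcal{Y}$ is extreme supported nondominated if there is no convex combination of nondominated points $y^{(1)},\dots,y^{(N)}\in\mathcal{Y}\setminus\{y\}$ with $\sum_i\lambda_iy^{(i)}\le y$; $x$ is extreme supported efficient if $g(x)$ is extreme supported nondominated. A representative set of extreme supported efficient solutions is a subset of $\mathcal{X}$ whose image under $g$ is exactly the set of extreme supported nondominated points. For $\lambda\in\mathbb{R}^2$ with $\lambda\ge0$, $\lambda\neq0$, let $D(\mathcal{U},\lambda)$ be $$\min_{x\in\mathcal{X},\,\pi^{(1)},\pi^{(2)}\in\mathbb{R}^{m'}}\Bigl\{d^t\sum_{i=1}^2\lambda_i\pi^{(i)}:\ C^t\pi^{(i)}=\hat c_i(x),\ \pi^{(i)}\ge0,\ i=1,2\Bigr\},$$ and let $g_\lambda(x)$ be the minimum of $d^t\sum_i\lambda_i\pi^{(i)}$ over $\pi^{(1)},\pi^{(2)}$ under the same constraints for fixed $x$. DA: Let $\epsilon_1$ be the optimal value of $D(\mathcal{U},(1,0))$; determine $x^L\in\arg\min_{x\in\mathcal{X}}\{g_{(0,1)}(x):g_{(1,0)}(x)\le\epsilon_1\}$ and set $y^L=(\epsilon_1,g_{(0,1)}(x^L))^t$.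 Let $\epsilon_2$ be the optimal value of $D(\mathcal{U},(0,1))$; determine $x^R\in\arg\min_{x\in\mathcal{X}}\{g_{(1,0)}(x):g_{(0,1)}(x)\le\epsilon_2\}$ and set $y^R=(g_{(1,0)}(x^R),\epsilon_2)^t$. If $y^L=y^R$, return $Y^\ast=\{y^L\}$, $X^\ast=\{x^L\}$. Otherwise set $Y^\ast=\{y^L,y^R\}$, $X^\ast=\{x^L,x^R\}$, $\mathcal{L}=\{(y^L,y^R)\}$. While $\mathcal{L}\ne\emptyset$: remove $(y^l,y^r)$ from $\mathcal{L}$; set $\lambda=(y^l_2-y^r_2,\,y^r_1-y^l_1)$; find one optimal solution $(x^\ast,\pi^{(1)\ast},\pi^{(2)\ast})$ of $D(\mathcal{U},\lambda)$ and set $y_i^\ast=d^t\pi^{(i)\ast}$, $i=1,2$; if $\lambda^Ty^\ast\ne\lambda^Ty^l$, add $y^\ast$ to $Y^\ast$, $x^\ast$ to $X^\ast$, and $(y^l,y^\ast),(y^\ast,y^r)$ to $\mathcal{L}$. Finally, points of $Y^\ast$ that are not extreme supported nondominated, and the corresponding solutions in $X^\ast$, are removed; return $X^\ast,Y^\ast$. Subproblems are assumed to be solved exactly. *)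

(* Defs.v *)
From mathcomp Require Import all_boot all_order all_algebra.
From mathcomp Require Import all_classical all_reals all_analysis.
From Stdlib Require Import Relation_Operators.

Set Implicit Arguments.
Unset Strict Implicit.
Unset Printing Implicit Defensive.

Import Order.TTheory GRing.Theory Num.Theory.
Import numFieldNormedType.Exports.

Local Open Scope classical_set_scope.
Local Open Scope ring_scope.

Definition dot (R : realType) (p : nat) (u v : 'cV[R]_p) : R :=
  (u^T *m v) 0 0.

Definition levec (R : realType) (p : nat) (u v : 'cV[R]_p) : Prop :=
  forall i, u i 0 <= v i 0.

Definition dominates (R : realType) (p : nat) (u v : 'cV[R]_p) : Prop :=
  levec u v /\ u <> v.

Definition polyhedron (R : realType) (q p : nat)
    (A : 'M[R]_(q, p)) (b : 'cV[R]_q) : set 'cV[R]_p :=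
  [set z | levec (A *m z) b].

Definition is_polytope (R : realType) (p : nat) (P : set 'cV[R]_p) : Prop :=
  (exists q (A : 'M[R]_(q, p)) (b : 'cV[R]_q), P = polyhedron A b) /\
  bounded_set P.

(* Z^k x R^(n-k) *)
Definition mixed_integer (R : realType) (n k : nat) : set 'cV[R]_n :=
  [set x | forall i : 'I_n, (i < k)%N -> x i 0 \is a Num.int].

Definition BRO1 (R : realType) (n : nat) (X : set 'cV[R]_n) : Prop :=
  X !=set0 /\
  exists k (P : set 'cV[R]_n),
    [/\ (k <= n)%N, is_polytope P & X = P `&` mixed_integer k].

(* The objectives are total Coq functions; only their values on X and U
   matter, and every condition below is relative to these sets. *)

Definition linear_on (R : realType) (p : nat) (D : set 'cV[R]_p)
    (h : 'cV[R]_p -> R) : Prop :=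
  exists l : {scalar 'cV[R]_p}, forall z, D z -> h z = l z.

Definition quasiconvex_on (R : realType) (p : nat) (D : set 'cV[R]_p)
    (h : 'cV[R]_p -> R) : Prop :=
  forall (z z' : 'cV[R]_p) (t : R), D z -> D z' -> 0 <= t <= 1 ->
    h (t *: z + (1 - t) *: z') <= Num.max (h z) (h z').

Definition BRO3 (R : realType) (n m : nat) (X : set 'cV[R]_n)
    (U : set 'cV[R]_m) (f : 'I_2 -> 'cV[R]_n -> 'cV[R]_m -> R) : Prop :=
  forall i,
    (forall xi, U xi -> linear_on X (fun x => f i x xi)) /\
    (forall x, X x ->
      quasiconvex_on U (f i x) /\ {within U, continuous (f i x)}).

Definition bilinear_on (R : realType) (n m : nat) (X : set 'cV[R]_n)
    (U : set 'cV[R]_m) (h : 'cV[R]_n -> 'cV[R]_m -> R) : Prop :=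
  (forall xi, U xi -> linear_on X (fun x => h x xi)) /\
  (forall x, X x -> linear_on U (h x)).

Definition robust_obj (R : realType) (n m : nat) (U : set 'cV[R]_m)
    (f : 'I_2 -> 'cV[R]_n -> 'cV[R]_m -> R) (x : 'cV[R]_n) : 'cV[R]_2 :=
  \col_i sup (f i x @` U).

Definition efficient (R : realType) (n p : nat) (X : set 'cV[R]_n)
    (g : 'cV[R]_n -> 'cV[R]_p) (x : 'cV[R]_n) : Prop :=
  X x /\ ~ exists x', [/\ X x', x' <> x & dominates (g x') (g x)].

Definition nondominated (R : realType) (n p : nat) (X : set 'cV[R]_n)
    (g : 'cV[R]_n -> 'cV[R]_p) (y : 'cV[R]_p) : Prop :=
  exists2 x, efficient X g x & g x = y.

Definition extreme_supported (R : realType) (n p : nat) (X : set 'cV[R]_n)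
    (g : 'cV[R]_n -> 'cV[R]_p) (y : 'cV[R]_p) : Prop :=
  (g @` X) y /\
  ~ exists (N : nat) (w : 'I_N -> R) (v : 'I_N -> 'cV[R]_p),
      [/\ forall j, nondominated X g (v j) /\ v j <> y,
          forall j, 0 <= w j,
          \sum_j w j = 1
        & levec (\sum_j w j *: v j) y].

Definition representative_set (R : realType) (n p : nat) (X : set 'cV[R]_n)
    (g : 'cV[R]_n -> 'cV[R]_p) (S : set 'cV[R]_n) : Prop :=
  S `<=` X /\ g @` S = [set y | extreme_supported X g y].

Definition is_argmin (R : realType) (T : Type) (S : set T) (obj : T -> R)
    (s : T) : Prop :=
  S s /\ forall s', S s' -> obj s <= obj s'.

Definition is_opt_value (R : realType) (T : Type) (S : set T) (obj : T -> R)
    (v : R) : Prop :=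
  exists2 s, is_argmin S obj s & obj s = v.

Definition dual_obj (R : realType) (m' : nat) (d : 'cV[R]_m')
    (lam : 'cV[R]_2) (pi : 'I_2 -> 'cV[R]_m') : R :=
  dot d (\sum_i lam i 0 *: pi i).

Definition dual_feasible (R : realType) (n m m' : nat) (C : 'M[R]_(m', m))
    (c : 'I_2 -> 'cV[R]_n -> 'cV[R]_m) (x : 'cV[R]_n) :
    set ('I_2 -> 'cV[R]_m') :=
  [set pi | forall i, C^T *m pi i = c i x /\ levec 0 (pi i)].

Definition D_feasible (R : realType) (n m m' : nat) (X : set 'cV[R]_n)
    (C : 'M[R]_(m', m)) (c : 'I_2 -> 'cV[R]_n -> 'cV[R]_m) :
    set ('cV[R]_n * ('I_2 -> 'cV[R]_m')) :=
  [set z | X z.1 /\ dual_feasible C c z.1 z.2].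

Definition D_obj (R : realType) (n m' : nat) (d : 'cV[R]_m')
    (lam : 'cV[R]_2) (z : 'cV[R]_n * ('I_2 -> 'cV[R]_m')) : R :=
  dual_obj d lam z.2.

(* The minimum over the dual variables for fixed x; the default value 0 of
   xget is only taken if this minimum is not attained. *)
Definition dual_value (R : realType) (n m m' : nat) (C : 'M[R]_(m', m))
    (d : 'cV[R]_m') (c : 'I_2 -> 'cV[R]_n -> 'cV[R]_m)
    (lam : 'cV[R]_2) (x : 'cV[R]_n) : R :=
  xget 0 [set v | is_opt_value (dual_feasible C c x) (dual_obj d lam) v].

Definition vec2 (R : realType) (a b : R) : 'cV[R]_2 :=
  \col_i (if i == 0 then a else b).

(* In [Loop L S], L lists the pairs of points still to be examined, and S
   lists the pairs (x, y) of a solution found and its point, so that the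
   correspondence between X^* and Y^* is kept. *)
Inductive da_state (R : realType) (n : nat) : Type :=
| Start
| Loop (L : seq ('cV[R]_2 * 'cV[R]_2)) (S : seq ('cV[R]_n * 'cV[R]_2))
| Returned (Xs : set 'cV[R]_n) (Ys : set 'cV[R]_2).

Arguments Start {R n}.
Arguments Loop {R n} L S.
Arguments Returned {R n} Xs Ys.

Definition lex_left (R : realType) (n m m' : nat) (X : set 'cV[R]_n)
    (C : 'M[R]_(m', m)) (d : 'cV[R]_m') (c : 'I_2 -> 'cV[R]_n -> 'cV[R]_m)
    (xL : 'cV[R]_n) (yL : 'cV[R]_2) : Prop :=
  let g := dual_value C d c in
  exists e1,
    [/\ is_opt_value (D_feasible X C c) (D_obj d (vec2 1 0)) e1,
        is_argmin [set x | X x /\ g (vec2 1 0) x <= e1] (g (vec2 0 1)) xL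
      & yL = vec2 e1 (g (vec2 0 1) xL)].

Definition lex_right (R : realType) (n m m' : nat) (X : set 'cV[R]_n)
    (C : 'M[R]_(m', m)) (d : 'cV[R]_m') (c : 'I_2 -> 'cV[R]_n -> 'cV[R]_m)
    (xR : 'cV[R]_n) (yR : 'cV[R]_2) : Prop :=
  let g := dual_value C d c in
  exists e2,
    [/\ is_opt_value (D_feasible X C c) (D_obj d (vec2 0 1)) e2,
        is_argmin [set x | X x /\ g (vec2 0 1) x <= e2] (g (vec2 1 0)) xR
      & yR = vec2 (g (vec2 1 0) xR) e2].

Definition chord_weight (R : realType) (yl yr : 'cV[R]_2) : 'cV[R]_2 :=
  vec2 (yl 1 0 - yr 1 0) (yr 0 0 - yl 0 0).

(* [E] is the set of extreme supported nondominated points of the problem,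
   used by the final clean-up only. *)
Inductive da_step (R : realType) (n m m' : nat) (X : set 'cV[R]_n)
    (C : 'M[R]_(m', m)) (d : 'cV[R]_m') (c : 'I_2 -> 'cV[R]_n -> 'cV[R]_m)
    (E : set 'cV[R]_2) : da_state R n -> da_state R n -> Prop :=
| da_init_single xL yL xR yR :
    lex_left X C d c xL yL -> lex_right X C d c xR yR -> yL = yR ->
    da_step X C d c E Start (Returned [set xL] [set yL])
| da_init_pair xL yL xR yR :
    lex_left X C d c xL yL -> lex_right X C d c xR yR -> yL <> yR ->
    da_step X C d c E Start (Loop [:: (yL, yR)] [:: (xL, yL); (xR, yR)])
| da_split L S yl yr xs pis ys :
    (yl, yr) \in L ->
    is_argmin (D_feasible X C c) (D_obj d (chord_weight yl yr)) (xs, pis) ->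
    ys = \col_i dot d (pis i) ->
    dot (chord_weight yl yr) ys <> dot (chord_weight yl yr) yl ->
    da_step X C d c E (Loop L S)
      (Loop ((yl, ys) :: (ys, yr) :: rem (yl, yr) L) ((xs, ys) :: S))
| da_discard L S yl yr xs pis ys :
    (yl, yr) \in L ->
    is_argmin (D_feasible X C c) (D_obj d (chord_weight yl yr)) (xs, pis) ->
    ys = \col_i dot d (pis i) ->
    dot (chord_weight yl yr) ys = dot (chord_weight yl yr) yl ->
    da_step X C d c E (Loop L S) (Loop (rem (yl, yr) L) S)
| da_finish S :
    da_step X C d c E (Loop [::] S)
      (Returned [set x | exists2 y, (x, y) \in S & E y]
                [set y | exists2 x, (x, y) \in S & E y]).

Definition is_returned (R : realType) (n : nat) (s : da_state R n) : Prop :=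
  exists Xs Ys, s = Returned Xs Ys.

(* Total correctness: whatever optimal solutions and whatever pairs of L are
   chosen, the run stops, never gets stuck before returning, and returns a
   correct result. *)
Definition da_solves (R : realType) (n m m' : nat) (X : set 'cV[R]_n)
    (C : 'M[R]_(m', m)) (d : 'cV[R]_m') (c : 'I_2 -> 'cV[R]_n -> 'cV[R]_m)
    (g : 'cV[R]_n -> 'cV[R]_2) : Prop :=
  let E := [set y | extreme_supported X g y] in
  let step := da_step X C d c E in
  let reachable := clos_refl_trans _ step Start in
  [/\ Acc (fun s' s => step s s') Start,
      forall s, reachable s -> ~ is_returned s -> exists s', step s s'
    & forall Xs Ys, reachable (Returned Xs Ys) ->
        representative_set X g Xs /\ Ys = E].

(* Main.v *)
Require Import Defs.
From mathcomp Require Import all_boot all_order all_algebra.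
From mathcomp Require Import all_classical all_reals all_analysis.
From mathcomp Require Import lra zify.
From Stdlib Require Import Relation_Operators.
Import Order.TTheory GRing.Theory Num.Theory.
Import numFieldNormedType.Exports.
Local Open Scope classical_set_scope.
Local Open Scope ring_scope.

(* By linear programming duality, the optimal dual values for fixed [x] are the
   components of [f^U(x)], and these are maxima of finitely many linear functions
   of [x], one per vertex of [U].  For each assignment of the integer variables
   the epigraph is a polyhedron; the vertices of these finitely many epigraphs
   project to a finite list [s] of points of the plane which lie above image
   points and suffice to minimize every positive weight over the image.

   Termination: the point found by a split need not be extreme, but each of the
   two new chords has strictly fewer points of [s] below it than the old one.

   Correctness: every extreme supported point has been found already or lies,
   in its first coordinate, strictly between the endpoints of a pair in [L].  A
   discarded pair has no such point between its endpoints, since that point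
   would lie above the chord, hence be dominated by a convex combination. *)

(** * Farkas' lemma *)

Section ScalarFunctions.
Context {R : realFieldType} {V : lmodType R} {f : V -> R} (f_lin : scalar f).

Lemma scalar_fun0 : f 0 = 0.
Proof. by have := f_lin 1 0 0; rewrite scaler0 addr0; lra. Qed.

Lemma scalar_funZ k x : f (k *: x) = k * f x.
Proof. by rewrite -[k *: x]addr0 f_lin scalar_fun0 addr0. Qed.

Lemma scalar_funD x y : f (x + y) = f x + f y.
Proof. by rewrite -{1}[x]scale1r f_lin mul1r. Qed.

Lemma scalar_funN x : f (- x) = - f x.
Proof. by rewrite -scaleN1r scalar_funZ mulN1r. Qed.

Lemma scalar_funB x y : f (x - y) = f x - f y.
Proof. by rewrite scalar_funD scalar_funN. Qed.

End ScalarFunctions.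

(* Induction on the number of constraints (Bartl): if the constraint [a j] is
   needed, a witness [xb] violating the conclusion without it satisfies
   [a j xb > 0], and all the data can be projected along [xb] onto the kernel
   of [a j]. *)
Lemma farkas_seq (R : realFieldType) (V : lmodType R) (J : eqType)
    (a : J -> V -> R) (r : seq J) (c : V -> R) :
  uniq r -> (forall j, scalar (a j)) -> scalar c ->
  (forall x, (forall j, j \in r -> a j x <= 0) -> c x <= 0) ->
  exists w : J -> R, (forall j, 0 <= w j) /\
    forall x, c x = \sum_(j <- r) w j * a j x.
Proof.
elim: r a c => [|j0 r IH] a c /=.
  move=> _ _ hc le0; exists (fun=> 0); split=> // x.
  have h1 : c x <= 0 by apply: le0.
  have h2 : c (- x) <= 0 by apply: le0.
  rewrite scalar_funN // in h2; rewrite big_nil; lra.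
move=> /andP[j0r ur] ha hc le0.
have [noneed|] := pselect (forall x, (forall j, j \in r -> a j x <= 0) -> c x <= 0).
  have [w [w0 hw]] := IH a c ur ha hc noneed.
  exists (fun j => if j == j0 then 0 else w j); split=> [j|x].
    by case: ifP.
  rewrite big_cons eqxx mul0r add0r hw; apply: eq_big_seq => j jr.
  by case: eqP => // ej; rewrite -ej jr in j0r.
move=> /existsNP[xb /not_implyP[axb cxb]].
have {}cxb : 0 < c xb by rewrite ltNge; apply/negP.
have aj0 : 0 < a j0 xb.
  rewrite ltNge; apply/negP => h.
  suff : c xb <= 0 by rewrite leNgt cxb.
  by apply: le0 => j; rewrite inE => /predU1P[->|/axb].
pose q x := a j0 x / a j0 xb.
pose a' j x := a j x - a j xb * q x.
pose c' x := c x - c xb * q x.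
have hq k x y : q (k *: x + y) = k * q x + q y.
  by rewrite /q ha mulrDl mulrA.
have ha' j : scalar (a' j) by move=> k x y; rewrite /a' hq ha; lra.
have hc' : scalar c' by move=> k x y; rewrite /c' hq hc; lra.
have [x ax|w [w0 hw]] := IH a' c' ur ha' hc'.
  have yE f : scalar f -> f (- q x *: xb + x) = f x - f xb * q x.
    by move=> hf; rewrite hf; lra.
  rewrite -[c' x]yE //; apply: le0 => j; rewrite inE => /predU1P[->|jr].
    by rewrite yE // /q mulrC divfK ?subrr ?gt_eqF.
  by rewrite yE //; apply: ax.
pose w0' := (c xb - \sum_(j <- r) w j * a j xb) / a j0 xb.
exists (fun j => if j == j0 then w0' else w j); split=> [j|x].
  case: ifP => // _; rewrite divr_ge0 ?(ltW aj0)// subr_ge0.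
  rewrite (le_trans _ (ltW cxb))// big_seq sumr_le0// => i ir.
  by rewrite mulr_ge0_le0 ?axb.
rewrite big_cons eqxx.
under eq_big_seq => j jr.
  have /negPf-> : j != j0 by apply: contraNneq j0r => <-.
  over.
have /eqP := hw x; rewrite /c' subr_eq => /eqP ->.
have -> : \sum_(j <- r) w j * a' j x
    = \sum_(j <- r) w j * a j x - (\sum_(j <- r) w j * a j xb) * q x.
  by rewrite mulr_suml -sumrB; apply: eq_bigr => j _; rewrite /a'; lra.
rewrite /w0' /q.
set S1 := \sum_(_ <- _) _; set S2 := \sum_(_ <- _) _.
lra.
Qed.

(** Homogenization: a coordinate [z.2], constrained by [- z.2 <= 0], turns the affine system into a
    cone to which [farkas_seq] applies. Evaluating the resulting identity at [(z, 0)] gives the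
    multipliers, at [(0, 1)] the bound on [beta]. *)
Lemma farkas_affine (R : realFieldType) (V : lmodType R) (J : finType)
    (a : J -> V -> R) (b : J -> R) (c : V -> R) (beta : R) (z0 : V) :
  (forall j, scalar (a j)) -> scalar c ->
  (forall j, a j z0 <= b j) ->
  (forall z, (forall j, a j z <= b j) -> c z <= beta) ->
  exists w : J -> R, [/\ forall j, 0 <= w j,
    forall z, c z = \sum_j w j * a j z & \sum_j w j * b j <= beta].
Proof.
move=> ha hc hz0 hbeta.
pose A (j : J + unit) (z : V * R^o) : R :=
  if j is inl j then a j z.1 - b j * z.2 else - z.2.
pose c' (z : V * R^o) : R := c z.1 - beta * z.2.
have hA j : scalar (A j).
  case: j => [j|u] k [x s] [y t] /=; rewrite /A /=; last first.
    by rewrite /GRing.scale /=; lra.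
  by rewrite ha /GRing.scale /=; lra.
have hc' : scalar c'.
  by move=> k [x s] [y t]; rewrite /c' /= hc /GRing.scale /=; lra.
have [[x s] /= hx|w [w0 hw]] :=
    @farkas_seq R _ _ A (index_enum _) c' (index_enum_uniq _) hA hc'.
  have {}hx j : A j (x, s) <= 0 by apply: hx; rewrite mem_index_enum.
  have := hx (inr tt); rewrite /A /= oppr_le0 le_eqVlt => /predU1P[s0|s0].
    rewrite /c' /= -s0 mulr0 subr0 leNgt; apply/negP => cx.
    have ax j : a j x <= 0 by have := hx (inl j); rewrite /A /= -s0; lra.
    (* With [s = 0], [x] is a recession direction. If [c x] were positive, this step length would
       give [c] the value [beta + 1] at the feasible point [t *: x + z0]. *)
    pose t := (beta - c z0 + 1) / c x.
    have t0 : 0 <= t.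
      by rewrite divr_ge0 ?(ltW cx)//; have := hbeta z0 hz0; lra.
    have : c (t *: x + z0) <= beta.
      apply: hbeta => j; rewrite ha; have := hz0 j.
      by have := mulr_ge0_le0 t0 (ax j); lra.
    by rewrite hc /t divfK ?gt_eqF//; lra.
  have := hbeta (s^-1 *: x); rewrite scalar_funZ// => hb.
  rewrite /c' /= subr_le0 -ler_pdivrMr// mulrC; apply: hb => j.
  rewrite scalar_funZ// mulrC ler_pdivrMr//.
  by have := hx (inl j); rewrite /A /=; lra.
exists (fun j => w (inl j)); split=> [j//|z|].
  have := hw (z, 0); rewrite /c' /= mulr0 subr0 => ->.
  rewrite big_sumType /= [X in _ + X]big1 ?addr0 => [|i _]; last first.
    by rewrite oppr0 mulr0.
  by apply: eq_bigr => j _; rewrite mulr0 subr0.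
have := hw (0, 1); rewrite /c' /= scalar_fun0// mulr1 sub0r big_sumType /=.
under eq_bigr do rewrite scalar_fun0// mulr1 sub0r mulrN.
rewrite sumrN.
have : \sum_(i : unit) w (inr i) * - 1 <= 0.
  by apply: sumr_le0 => i _; rewrite mulr_ge0_le0 ?lerN10.
set S1 := \sum_(_ : unit) _; set S2 := \sum_(_ : J) _.
by rewrite -[in X in X -> _]/S1; lra.
Qed.

(** * Vertices of polyhedra *)

(** Applied to a difference [x - y], this is the lexicographic comparison of [x] with [y]: [phi]
    decides and [psi] breaks ties. With [psi] zero it reduces to [phi h <= 0]. *)
Definition lex_neg {R : realFieldType} {V : Type} (phi psi : V -> R) (h : V) :=
  phi h < 0 \/ phi h = 0 /\ psi h <= 0.

Section LexNeg.
Context {R : realFieldType} {V : lmodType R} {phi psi : V -> R}.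
Hypotheses (hphi : scalar phi) (hpsi : scalar psi).

Lemma lex_neg0 : lex_neg phi psi 0.
Proof. by right; rewrite !scalar_fun0. Qed.

Lemma lex_negD x y :
  lex_neg phi psi x -> lex_neg phi psi y -> lex_neg phi psi (x + y).
Proof.
rewrite /lex_neg !scalar_funD//.
by case=> [x0|[x0 x1]] [y0|[y0 y1]]; [left|left|left|right;split]; lra.
Qed.

Lemma lex_neg_total h : lex_neg phi psi h \/ lex_neg phi psi (- h).
Proof.
rewrite /lex_neg !scalar_funN//.
case: (ltgtP (phi h) 0) => [?|?|->]; first by left; left.
  by right; left; lra.
by case: (leP (psi h) 0) => ?; [left|right]; right; split=> //; lra.
Qed.

Lemma lex_negZ k h : 0 <= k -> lex_neg phi psi h -> lex_neg phi psi (k *: h).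
Proof.
rewrite le_eqVlt => /predU1P[<-|k0]; first by rewrite scale0r => _; exact: lex_neg0.
case=> [h0|[h0 h1]]; [left|right]; rewrite !scalar_funZ//.
  by rewrite pmulr_rlt0.
by rewrite h0 mulr0 pmulr_rle0.
Qed.

Lemma lex_min_seq (v0 : V) (s : seq V) : v0 \in s ->
  exists2 v, v \in s & forall v', v' \in s -> lex_neg phi psi (v - v').
Proof.
elim: s v0 => // u [|u' s] IH v0 _.
  exists u; rewrite ?mem_head// => v'; rewrite inE => /eqP ->.
  by rewrite subrr; exact: lex_neg0.
have [v vs hv] := IH u' (mem_head _ _).
have [h|h] := lex_neg_total (v - u).
  exists v => [|v']; first by rewrite inE vs orbT.
  by rewrite inE => /predU1P[->//|/hv].
exists u => [|v']; first exact: mem_head.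
rewrite inE => /predU1P[->|/hv h']; first by rewrite subrr; exact: lex_neg0.
by rewrite -(subrKA v); apply: lex_negD => //; rewrite -opprB.
Qed.

End LexNeg.

(* The points at which the active constraints determine the point: these are
   the vertices.  From any other point one can move along a direction
   annihilated by the active constraints, in the lexicographically descending
   sense, until a further constraint becomes active. *)
Lemma finite_vertices (R : realFieldType) (V : lmodType R) (J : finType)
    (a : J -> V -> R) (b : J -> R) :
  (forall j, scalar (a j)) ->
  exists B : set V, [/\ finite_set B, forall v, B v -> forall j, a j v <= b j &
    forall phi psi, scalar phi -> scalar psi ->
    (forall h, (forall j, a j h <= 0) -> lex_neg phi psi h -> h = 0) ->
    forall z, (forall j, a j z <= b j) ->
    exists2 v, B v & lex_neg phi psi (v - z)].
Proof.
move=> ha.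
pose act z : {set J} := [set j | a j z == b j]%SET.
pose B := [set z | (forall j, a j z <= b j) /\
  forall h, (forall j, j \in act z -> a j h = 0) -> h = 0].
exists B; split.
- have actI z z' : B z -> B z' -> act z = act z' -> z = z'.
    move=> [_ hz] [_ hz'] e.
    apply/eqP; rewrite -subr_eq0; apply/eqP/hz => j jz.
    have : j \in act z' by rewrite -e.
    by move: jz; rewrite !inE scalar_funB// => /eqP -> /eqP ->; rewrite subrr.
  (* Since a point of [B] is determined by its active set, [B] lies in the image of the finite type
     of index sets. *)
  pose pt I := xget 0 [set z | B z /\ act z = I].
  apply: (@sub_finite_set _ _ (pt @` setT)); last exact: finite_image.
  move=> z Bz; exists (act z) => //.
  have [Bz' ez'] : [set z' | B z' /\ act z' = act z] (pt (act z)).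
    by apply: xgetPex; exists z.
  exact: actI.
- by move=> v [].
move=> phi psi hphi hpsi rec z.
(* Induction on the number of inactive constraints. *)
have [n] := ubnP #|~: act z|; elim: n z => // n IH z ltn hz.
have [|nB] := pselect (B z).
  by exists z => //; rewrite subrr; exact: lex_neg0.
have {nB} [h hact h0] : exists2 h, (forall j, j \in act z -> a j h = 0) & h != 0.
  have /not_andP[//|/existsNP[h /not_implyP[hh h0]]] := nB.
  by exists h => //; apply/eqP.
wlog hneg : h hact h0 / lex_neg phi psi h.
  move=> W; have [|] := lex_neg_total hphi hpsi h; first exact: W.
  apply: W => [j /hact|]; last by rewrite oppr_eq0.
  by rewrite scalar_funN// => ->; rewrite oppr0.
have [j0 hj0] : exists j0, 0 < a j0 h.
  apply: contrapT => /forallNP nj; move/eqP: h0; apply; apply: rec => // j.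
  by rewrite leNgt; apply/negP.
(* Ratio test: [F j] is the step along [h] at which constraint [j] becomes active. The least such
   step keeps feasibility and activates [j1], which was inactive at [z]. *)
pose F j := (b j - a j z) / a j h.
case: (@arg_minP _ _ _ j0 (fun j => 0 < a j h) F hj0) => j1 hj1 minF.
have t0 : 0 <= F j1 by rewrite divr_ge0 ?(ltW hj1) ?subr_ge0.
pose z1 := F j1 *: h + z.
have hz1 j : a j z1 <= b j.
  rewrite ha; case: (ltP 0 (a j h)) => ajh.
    have := minF j ajh; rewrite {2}/F ler_pdivlMr//; lra.
  have := mulr_ge0_le0 t0 ajh; have := hz j; lra.
have [|v Bv hv] := IH z1 _ hz1.
  rewrite (leq_trans _ (ltnSE ltn))//; apply: proper_card; apply/properP; split.
    apply/fintype.subsetP => j; rewrite !inE; apply: contra => /eqP jz.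
    by rewrite ha hact ?inE ?jz// mulr0 add0r.
  exists j1; rewrite !inE.
    apply: contraTN hj1 => j1z; rewrite hact ?ltxx// inE; exact: j1z.
  by rewrite negbK ha /F divfK ?subrK// gt_eqF.
exists v => //; rewrite -(subrKA z1).
by apply: lex_negD => //; rewrite /z1 addrK; apply: lex_negZ.
Qed.

(** * Polytopes and their mixed-integer slices *)

Lemma dotE (R : realType) (p : nat) (u v : 'cV[R]_p) :
  dot u v = \sum_i u i 0 * v i 0.
Proof. by rewrite /dot mxE; apply: eq_bigr => i _; rewrite mxE. Qed.

Lemma dot_scalar (R : realType) (p : nat) (w : 'cV[R]_p) : scalar (dot w).
Proof. by move=> k x y; rewrite /dot mulmxDr -scalemxAr !mxE. Qed.

Lemma scalar_mulmx_coord (R : realType) (q p : nat) (A : 'M[R]_(q, p)) j :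
  scalar (fun z : 'cV[R]_p => (A *m z) j 0).
Proof. by move=> k x y; rewrite mulmxDr -scalemxAr !mxE. Qed.

Lemma bounded_set_coord (R : realType) (p : nat) (P : set 'cV[R]_p) :
  bounded_set P -> exists M : R, forall x, P x -> forall i, `|x i 0| <= M.
Proof.
move=> /pinfty_ex_gt0[M _ hM]; exists M => x Px i.
apply: le_trans (hM x Px).
by rewrite [leRHS]mx_normrE (le_bigmax _ (fun ij => `|x ij.1 ij.2|) (i, 0)).
Qed.

(** Translating a feasible point by any nonnegative multiple of [h] stays in the polyhedron, so a
    nonzero [h] would contradict boundedness. *)
Lemma polytope_recession (R : realType) (q p : nat) (A : 'M[R]_(q, p))
    (b : 'cV[R]_q) :
  polyhedron A b !=set0 -> bounded_set (polyhedron A b) ->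
  forall h : 'cV[R]_p, (forall j, (A *m h) j 0 <= 0) -> h = 0.
Proof.
move=> [z0 z0P] /bounded_set_coord[M hM] h hA.
apply/matrixP => i j; rewrite ord1 mxE {j}; apply: contrapT => /eqP hi.
have hi0 : 0 < `|h i 0| by rewrite normr_gt0.
(* Chosen so that coordinate [i] of [t *: h + z0] has absolute value at least [M + 1]. *)
pose t := (M + `|z0 i 0| + 1) / `|h i 0|.
have M0 : 0 <= M := le_trans (normr_ge0 _) (hM _ z0P i).
have t0 : 0 <= t by rewrite divr_ge0 ?(ltW hi0)// !addr_ge0.
have /hM/(_ i) : polyhedron A b (t *: h + z0).
  move=> j; rewrite scalar_mulmx_coord.
  by have := mulr_ge0_le0 t0 (hA j); have := z0P j; lra.
rewrite !mxE => le1.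
have := ler_normB (t * h i 0 + z0 i 0) (z0 i 0).
rewrite addrK normrM (ger0_norm t0) /t divfK ?gt_eqF//; lra.
Qed.

Lemma polytope_vertices (R : realType) (q p : nat) (A : 'M[R]_(q, p))
    (b : 'cV[R]_q) :
  polyhedron A b !=set0 -> bounded_set (polyhedron A b) ->
  exists B : seq 'cV[R]_p, (forall v, v \in B -> polyhedron A b v) /\
    forall w, exists2 v, v \in B & forall z, polyhedron A b z -> dot w z <= dot w v.
Proof.
move=> P0 Pb; have recP := @polytope_recession _ _ _ _ _ P0 Pb.
have [S [/finite_seqP[s ->] sP hs]] := @finite_vertices R _ _
  (fun j (z : 'cV[R]_p) => (A *m z) j 0) (fun j => b j 0) (scalar_mulmx_coord _ _ _ A).
exists s; split=> // w.
have hphi : scalar (fun z => - dot w z).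
  by move=> k x y; rewrite dot_scalar; lra.
have hpsi : scalar (fun _ : 'cV[R]_p => 0 : R) by move=> k x y; rewrite mulr0 addr0.
have {}hs := hs _ _ hphi hpsi (fun h hh _ => recP h hh).
have [z0 /hs[v0 v0s _]] := P0.
have [v vs hv] := lex_min_seq hphi hpsi _ _ v0s.
exists v => // z /hs[v' /hv v's h].
have := lex_negD hphi hpsi _ _ v's h.
by rewrite subrKA => -[|[]] /=; rewrite (scalar_funB (dot_scalar _ _ w)); lra.
Qed.

(* For fixed values [e] of the integer variables, the epigraph of the
   componentwise maximum of the [l i u] over a slice of [X] is a polyhedron; the
   points sought are the projections of its vertices. *)
Lemma finite_image_vertices (R : realType) (n k q : nat) (K : finType) (u0 : K)
    (A : 'M[R]_(q, n)) (b : 'cV[R]_q) (l : 'I_2 -> K -> 'cV[R]_n -> R)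
    (g : 'cV[R]_n -> 'cV[R]_2) (X := polyhedron A b `&` mixed_integer k) :
  X !=set0 -> bounded_set (polyhedron A b) ->
  (forall i u, scalar (l i u)) ->
  (forall x, X x -> forall i, (forall u, l i u x <= g x i 0) /\
    exists u, g x i 0 = l i u x) ->
  exists s : seq 'cV[R]_2,
    (forall v, v \in s -> exists2 x, X x & levec (g x) v) /\
    forall phi psi, scalar phi -> scalar psi ->
    (forall h, levec 0 h -> lex_neg phi psi h -> h = 0) ->
    forall x, X x -> exists2 v, v \in s & lex_neg phi psi (v - g x).
Proof.
move=> [x0 [x0P _]] Pb hl hg.
have recP : forall h : 'cV[R]_n, (forall j, (A *m h) j 0 <= 0) -> h = 0.
  by apply: polytope_recession Pb; exists x0.
have [M hM] := bounded_set_coord _ _ _ Pb.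
pose N := Num.bound M.
pose J := (('I_q + ('I_n + 'I_n)) + ('I_2 * K))%type.
(* The four groups describe membership in the polyhedron, the two inequalities fixing each integer
   coordinate, and the epigraph. For [i >= k] the fixing inequalities read [0 <= 0]. *)
pose a (j : J) (z : 'cV[R]_n * 'cV[R]_2) : R := match j with
  | inl (inl j) => (A *m z.1) j 0
  | inl (inr (inl i)) => if (i < k)%N then z.1 i 0 else 0
  | inl (inr (inr i)) => if (i < k)%N then - z.1 i 0 else 0
  | inr (i, u) => l i u z.1 - z.2 i 0
  end.
(* The codes from 0 to [2N] stand for the integers from [-N] to [N], which cover all integer
   coordinates of points of [X]. *)
pose ev (e : {ffun 'I_n -> 'I_(N + N).+1}) i : R := (e i)%:R - N%:R.
pose beta e (j : J) : R := match j with
  | inl (inl j) => b j 0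
  | inl (inr (inl i)) => if (i < k)%N then ev e i else 0
  | inl (inr (inr i)) => if (i < k)%N then - ev e i else 0
  | inr _ => 0
  end.
have ha j : scalar (a j).
  move=> t [x1 y1] [x2 y2]; case: j => [[j|[i|i]]|[i u]] /=.
  - exact: scalar_mulmx_coord.
  - by case: ifP => _; rewrite ?mxE; lra.
  - by case: ifP => _; rewrite ?mxE; lra.
  - by rewrite hl !mxE; lra.
have [B hB] := choice (fun e => @finite_vertices R _ J a (beta e) ha).
have [s hs] : exists s : seq 'cV[R]_2, snd @` (\bigcup_(e in setT) B e) = [set` s].
  apply/finite_seqP; apply: finite_image; apply: bigcup_finite => // e _.
  by have [] := hB e.
exists s; split.
  move=> v vs; have : [set` s] v by [].
  rewrite -hs => -[[x y] [e _ /= Be] <-] /=.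
  have [_ /(_ _ Be) hxy _] := hB e.
  have Xx : X x.
    split; first by move=> j; exact: hxy (inl (inl j)).
    move=> i ik; have := hxy (inl (inr (inl i))); have := hxy (inl (inr (inr i))).
    rewrite /= ik lerN2 => h1 h2.
    have -> : x i 0 = ev e i by apply/eqP; rewrite eq_le h1 h2.
    by rewrite rpredB ?natr_int.
  exists x => // i; have [_ [u ->]] := hg x Xx i.
  by have := hxy (inr (i, u)); rewrite /=; lra.
move=> phi psi hphi hpsi rec x Xx; have [Px ix] := Xx.
have [e he] : exists e, forall i : 'I_n, (i < k)%N -> x i 0 = ev e i.
  suff /choice[e he] : forall i : 'I_n, exists c : 'I_(N + N).+1,
      (i < k)%N -> x i 0 = c%:R - N%:R.
    by exists (finfun e) => i ik; rewrite /ev ffunE he.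
  move=> i; have [ik|] := boolP (i < k)%N; last by exists ord0.
  have /intrP[z ez] := ix i ik.
  have xN : `|x i 0| < N%:R.
    rewrite (le_lt_trans (hM x Px i))// archi_boundP//.
    exact: le_trans (normr_ge0 _) (hM x Px i).
  have : `|z| < N%:Z.
    by rewrite -(ltr_int R) intr_norm -ez.
  rewrite ltr_norml => /andP[zN1 zN2].
  have [c ec] : exists c : nat, z + N%:Z = c%:Z.
    by exists (absz (z + N%:Z)); lia.
  have cN : (c < (N + N).+1)%N.
    by rewrite -ltz_nat -ec; lia.
  exists (Ordinal cN) => _ /=.
  by rewrite ez -(addrK N%:Z z) ec intrB.
have hphi' : scalar (fun z : 'cV[R]_n * 'cV[R]_2 => phi z.2).
  by move=> t [x1 y1] [x2 y2]; exact: hphi.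
have hpsi' : scalar (fun z : 'cV[R]_n * 'cV[R]_2 => psi z.2).
  by move=> t [x1 y1] [x2 y2]; exact: hpsi.
have [_ _ /(_ _ _ hphi' hpsi')] := hB e.
case/(_ _ (x, g x)).
(* A recession direction of the epigraph has zero first part because the polytope is bounded. Its
   second part is then nonnegative, as the constraint for [u0] shows. *)
- move=> [h h'] hh /= hneg.
  have h0 : h = 0 by apply: recP => j; exact: hh (inl (inl j)).
  congr pair => //; apply: rec hneg => i.
  by have := hh (inr (i, u0)); rewrite h0 /= scalar_fun0// mxE; lra.
- move=> [[j|[i|i]]|[i u]] /=.
  + exact: Px.
  + by case: ifP => // ik; rewrite he.
  + by case: ifP => // ik; rewrite he.
  + by have [/(_ u)] := hg x Xx i; lra.
move=> v Bv hv; exists v.2 => //.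
suff : [set` s] v.2 by [].
by rewrite -hs; exists v => //; exists e.
Qed.

(** * Linear programming duality *)

Lemma lp_weak_duality (R : realType) (m m' : nat) (C : 'M[R]_(m', m))
    (d : 'cV[R]_m') (c : 'cV[R]_m) (pi : 'cV[R]_m') (xi : 'cV[R]_m) :
  polyhedron C d xi -> C^T *m pi = c -> levec 0 pi -> dot c xi <= dot d pi.
Proof.
move=> xiU <- pi0.
have -> : dot (C^T *m pi) xi = dot (C *m xi) pi.
  have -> : dot (C *m xi) pi = ((C *m xi)^T *m pi)^T 0 0 by rewrite [RHS]mxE.
  by rewrite /dot !trmx_mul !trmxK mulmxA.
rewrite !dotE ler_sum// => j _; apply: ler_wpM2r; last exact: xiU.
by have := pi0 j; rewrite mxE.
Qed.

(** The Farkas multipliers of the valid inequality [dot c xi <= beta] form the dual solution;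
    comparing both sides at unit vectors gives the equality constraints. *)
Lemma lp_strong_duality (R : realType) (m m' : nat) (C : 'M[R]_(m', m))
    (d : 'cV[R]_m') (c : 'cV[R]_m) (beta : R) :
  polyhedron C d !=set0 -> (forall xi, polyhedron C d xi -> dot c xi <= beta) ->
  exists pi, [/\ C^T *m pi = c, levec 0 pi & dot d pi <= beta].
Proof.
move=> [xi0 xi0U] hbeta.
have [w [w0 hw wd]] := @farkas_affine R _ _ _ (fun j => d j 0) _ beta xi0
  (scalar_mulmx_coord _ _ _ C) (dot_scalar _ _ c) xi0U hbeta.
exists (\col_j w j); split.
- apply/matrixP => i k; rewrite ord1 {k}.
  have := hw (delta_mx i 0); rewrite dotE (bigD1 i)//= mxE !eqxx mulr1.
  rewrite big1 ?addr0 => [->|k /negPf ki]; last by rewrite mxE ki mulr0.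
  rewrite mxE; apply: eq_bigr => j _; rewrite !mxE mulrC; congr (_ * _).
  rewrite (bigD1 i)//= mxE !eqxx mulr1 big1 ?addr0// => k /negPf ki.
  by rewrite mxE ki mulr0.
- by move=> j; rewrite !mxE.
- by rewrite dotE; under eq_bigr do rewrite mxE mulrC.
Qed.

(** * Chords in the plane *)

Lemma ord2P (P : 'I_2 -> Prop) : P 0 -> P 1 -> forall i, P i.
Proof.
move=> P0 P1 [[|[|//]] lti]; first by rewrite (_ : Ordinal lti = 0)//; apply: val_inj.
by rewrite (_ : Ordinal lti = 1)//; apply: val_inj.
Qed.

Lemma sum_ord2 (V : nmodType) (F : 'I_2 -> V) : \sum_i F i = F 0 + F 1.
Proof. by rewrite !big_ord_recl big_ord0 addr0; congr (_ + F _); apply: val_inj. Qed.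

Section Plane.
Context {R : realType}.
Implicit Types u v w a b : 'cV[R]_2.

Lemma dot2 u v : dot u v = u 0 0 * v 0 0 + u 1 0 * v 1 0.
Proof. by rewrite dotE sum_ord2. Qed.

Lemma levec2 u v : u 0 0 <= v 0 0 -> u 1 0 <= v 1 0 -> levec u v.
Proof. by move=> h0 h1; apply: ord2P. Qed.

Lemma cV2_eq u v : u 0 0 = v 0 0 -> u 1 0 = v 1 0 -> u = v.
Proof. by move=> h0 h1; apply/matrixP => i j; rewrite ord1; move: i; apply: ord2P. Qed.

Lemma vec2_0 (a b : R) : vec2 a b 0 0 = a. Proof. by rewrite mxE. Qed.
Lemma vec2_1 (a b : R) : vec2 a b 1 0 = b. Proof. by rewrite mxE. Qed.

Lemma dot_ge_levec w u v : levec 0 w -> levec u v -> dot w u <= dot w v.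
Proof.
move=> w0 uv; rewrite !dotE; apply: ler_sum => i _.
by apply: ler_wpM2l => //; have := w0 i; rewrite mxE.
Qed.

Lemma dot_pos_inj w u v : 0 < w 0 0 -> 0 < w 1 0 ->
  levec u v -> dot w v <= dot w u -> u = v.
Proof.
move=> w0 w1 uv; rewrite !dot2 => h.
have h0 : 0 <= w 0 0 * (v 0 0 - u 0 0) by rewrite mulr_ge0 ?(ltW w0) ?subr_ge0 ?uv.
have h1 : 0 <= w 1 0 * (v 1 0 - u 1 0) by rewrite mulr_ge0 ?(ltW w1) ?subr_ge0 ?uv.
have /eqP : w 0 0 * (v 0 0 - u 0 0) = 0 by lra.
have /eqP : w 1 0 * (v 1 0 - u 1 0) = 0 by lra.
rewrite !mulf_eq0 (gt_eqF w0) (gt_eqF w1) !subr_eq0 => /eqP e1 /eqP e0.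
exact: cV2_eq.
Qed.

Definition below a b v : bool := dot (chord_weight a b) v < dot (chord_weight a b) a.

Lemma belowE a b v : below a b v =
  ((a 1 0 - b 1 0) * v 0 0 + (b 0 0 - a 0 0) * v 1 0
   < (a 1 0 - b 1 0) * a 0 0 + (b 0 0 - a 0 0) * a 1 0).
Proof. by rewrite /below !dot2 vec2_0 vec2_1. Qed.

End Plane.

(* A point [z] strictly below the line through [a] and [b] but not to the right
   of [a] would put [a] above the segment from [z] to [b]. *)
Lemma right_of_supported (R : realFieldType) (a0 a1 b0 b1 z0 z1 al be : R) :
  0 <= al -> 0 <= be -> 0 < al + be ->
  al * a0 + be * a1 <= al * b0 + be * b1 ->
  al * a0 + be * a1 <= al * z0 + be * z1 ->
  (z0 <= a0 -> z1 <= a1 -> z0 = a0 /\ z1 = a1) ->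
  a0 < b0 -> b1 < a1 ->
  (a1 - b1) * z0 + (b0 - a0) * z1 < (a1 - b1) * a0 + (b0 - a0) * a1 ->
  a0 < z0.
Proof.
move=> al0 be0 albe hb hz nd ab0 ab1 bel; rewrite ltNge; apply/negP => z0a.
have [z1a|z1a] := leP z1 a1.
  by have [e0 e1] := nd z0a z1a; rewrite e0 e1 ltxx in bel.
have h1 : 0 <= (a0 - z0) * (al * (b0 - a0) + be * (b1 - a1)).
  by apply: mulr_ge0; lra.
have h2 : 0 <= (b0 - a0) * (be * (z1 - a1) + al * (z0 - a0)).
  by apply: mulr_ge0; lra.
(* [D] is negative since [z] is below the chord, while [h1] and [h2] add up to [0 <= be * D]. Hence
   [be = 0]; the supporting line is vertical, which forces [z0 = a0] and then [0 < D]. *)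
pose D := (a1 - b1) * (z0 - a0) + (b0 - a0) * (z1 - a1).
have D0 : D < 0 by rewrite /D; lra.
have beD : 0 <= be * D by rewrite /D; lra.
move: be0; rewrite le_eqVlt => /predU1P[be0|be0]; last first.
  by have := nmulr_llt0 be D0; rewrite be0; lra.
have al1 : 0 < al by lra.
have : 0 < (b0 - a0) * (z1 - a1) by apply: mulr_gt0; lra.
have : 0 <= al * (z0 - a0) by rewrite -be0 in hz; lra.
rewrite pmulr_rge0// => h; have e : z0 = a0 by lra.
by move: D0; rewrite /D e; lra.
Qed.

(** Compare slopes seen from [a]: that of [v] is less than that of [y], which is less than
    [- l0 / l1]. *)
Lemma below_chord_trans (R : realFieldType) (a0 a1 y0 y1 v0 v1 l0 l1 : R) :
  a0 < y0 -> a0 < v0 -> 0 < l1 ->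
  (a1 - y1) * (v0 - a0) + (y0 - a0) * (v1 - a1) < 0 ->
  l0 * (y0 - a0) + l1 * (y1 - a1) < 0 ->
  l0 * (v0 - a0) + l1 * (v1 - a1) < 0.
Proof.
move=> ay av l1_0 h1 h2.
rewrite -(pmulr_rlt0 _ (_ : 0 < y0 - a0)) ?subr_gt0//.
have h3 : l1 * ((a1 - y1) * (v0 - a0) + (y0 - a0) * (v1 - a1)) < 0.
  by rewrite pmulr_rlt0.
have h4 : (v0 - a0) * (l0 * (y0 - a0) + l1 * (y1 - a1)) < 0.
  by rewrite pmulr_rlt0// subr_gt0.
lra.
Qed.

(** For [y] to the right of [a], the path from [a] through [y] to [v] bends upwards at [y]: its
    first slope is less than [- l0 / l1], the slope of the line carrying [y] and [v]. *)
Lemma not_below_chord (R : realFieldType) (a0 a1 y0 y1 v0 v1 l0 l1 : R) :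
  y0 <= v0 -> 0 < l1 ->
  l0 * (v0 - y0) + l1 * (v1 - y1) = 0 ->
  l0 * (y0 - a0) + l1 * (y1 - a1) < 0 ->
  0 <= (a1 - y1) * (v0 - y0) + (y0 - a0) * (v1 - y1).
Proof.
move=> yv l1_0 h1 h2.
rewrite -(pmulr_rge0 _ l1_0).
have h3 : 0 <= (v0 - y0) * - (l0 * (y0 - a0) + l1 * (y1 - a1)).
  by apply: mulr_ge0; lra.
have : (y0 - a0) * (l0 * (v0 - y0) + l1 * (v1 - y1)) = 0 by rewrite h1 mulr0.
lra.
Qed.

Lemma count_lt (T : eqType) (p q : pred T) (s : seq T) v :
  (forall x, x \in s -> p x -> q x) -> v \in s -> q v -> ~~ p v ->
  (count p s < count q s)%N.
Proof.
move=> pq vs qv pv.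
have -> : count q s = (count p s + count (predD q p) s)%N.
  rewrite -count_predUI [X in (_ + X)%N](_ : _ = 0%N) ?addn0.
    apply: eq_in_count => x xs /=; case: (boolP (p x)) => //= px.
    by rewrite pq.
  by rewrite (eq_count (a2 := pred0)) ?count_pred0// => x /=; case: (p x).
by rewrite -addn1 leq_add2l -has_count; apply/hasP; exists v => //=; rewrite pv.
Qed.

(** * Runs of the dualization approach *)

Section DualizationApproach.
Context {R : realType} {n m m' : nat} (X : set 'cV[R]_n)
  (C : 'M[R]_(m', m)) (d : 'cV[R]_m') (c : 'I_2 -> 'cV[R]_n -> 'cV[R]_m)
  (g : 'cV[R]_n -> 'cV[R]_2) (s : seq 'cV[R]_2).
Context (X_neq0 : X !=set0)
  (strong_dual : forall x i, X x ->
     exists pi, [/\ C^T *m pi = c i x, levec 0 pi & dot d pi <= g x i 0])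
  (weak_dual : forall x i pi, X x ->
     C^T *m pi = c i x -> levec 0 pi -> g x i 0 <= dot d pi)
  (s_above : forall v, v \in s -> exists2 x, X x & levec (g x) v)
  (s_below : forall phi psi, scalar phi -> scalar psi ->
     (forall h, levec 0 h -> lex_neg phi psi h -> h = 0) ->
     forall x, X x -> exists2 v, v \in s & lex_neg phi psi (v - g x)).
Implicit Types (lam mu y a b : 'cV[R]_2) (x : 'cV[R]_n).

(** * Optimal solutions of the dual programs *)

Lemma dual_objE lam (pi : 'I_2 -> 'cV[R]_m') :
  dual_obj d lam pi = dot lam (\col_i dot d (pi i)).
Proof.
rewrite /dual_obj sum_ord2 (scalar_funD (dot_scalar _ _ d)).
by rewrite !(scalar_funZ (dot_scalar _ _ d)) dot2 !mxE.
Qed.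

Lemma dual_attained x : X x -> exists2 pi : 'I_2 -> 'cV[R]_m',
  dual_feasible C c x pi & \col_i dot d (pi i) = g x.
Proof.
move=> Xx; have /choice[pi hpi] := fun i => strong_dual x i Xx.
exists pi; first by move=> i; have [? ? _] := hpi i.
apply/matrixP => i j; rewrite ord1 mxE; have [h1 h2 h3] := hpi i.
by apply/eqP; rewrite eq_le h3 weak_dual.
Qed.

Lemma levec_dual x pi : X x -> dual_feasible C c x pi ->
  levec (g x) (\col_i dot d (pi i)).
Proof. by move=> Xx hpi i; rewrite mxE; have [] := hpi i; exact: weak_dual. Qed.

Lemma dual_valueE lam x : levec 0 lam -> X x ->
  dual_value C d c lam x = dot lam (g x).
Proof.
move=> lam0 Xx; have [pi pif pig] := dual_attained x Xx.
have piE : dual_obj d lam pi = dot lam (g x) by rewrite dual_objE pig.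
have ge pi' : dual_feasible C c x pi' -> dot lam (g x) <= dual_obj d lam pi'.
  by move=> /(levec_dual _ _ Xx); rewrite dual_objE; exact: dot_ge_levec.
(* The minimum is attained at [pi], so [xget] does not return its default value. *)
have [pi' [pif' min] <-] :
    is_opt_value (dual_feasible C c x) (dual_obj d lam) (dual_value C d c lam x).
  apply: (@xgetPex _ 0 (is_opt_value (dual_feasible C c x) (dual_obj d lam))).
  exists (dual_obj d lam pi); exists pi => //; split=> // pi' /ge.
  by rewrite piE.
by apply/eqP; rewrite eq_le ge// -piE min.
Qed.

Definition minimizes lam x := X x /\ forall x', X x' -> dot lam (g x) <= dot lam (g x').

(** Only the weighted values are compared: where [lam] has a zero component, the corresponding dual
    vector need not be optimal. Positive weights exclude this in [D_argmin_pos]. *)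
Lemma D_argminP lam z : levec 0 lam ->
  is_argmin (D_feasible X C c) (D_obj d lam) z ->
  minimizes lam z.1 /\ dot lam (\col_i dot d (z.2 i)) = dot lam (g z.1).
Proof.
case: z => x pi /= lam0 [[/= Xx pif] min].
have le x' : X x' -> dot lam (\col_i dot d (pi i)) <= dot lam (g x').
  move=> Xx'; have [pi' pif' pig'] := dual_attained x' Xx'.
  by have := min (x', pi') (conj Xx' pif'); rewrite /D_obj !dual_objE /= pig'.
have ge := dot_ge_levec _ _ _ lam0 (levec_dual _ _ Xx pif).
split; last by apply/eqP; rewrite eq_le le.
by split=> // x' /le; exact: le_trans.
Qed.

Lemma D_argmin_exists lam x : levec 0 lam -> minimizes lam x ->
  exists pi, is_argmin (D_feasible X C c) (D_obj d lam) (x, pi).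
Proof.
move=> lam0 [Xx min]; have [pi pif pig] := dual_attained x Xx.
exists pi; split=> // -[x' pi'] [/= Xx' pif'].
rewrite /D_obj !dual_objE /= pig (le_trans (min _ Xx'))//.
exact: dot_ge_levec (levec_dual _ _ _ _).
Qed.

Lemma D_argmin_pos lam z : 0 < lam 0 0 -> 0 < lam 1 0 ->
  is_argmin (D_feasible X C c) (D_obj d lam) z -> \col_i dot d (z.2 i) = g z.1.
Proof.
move=> l0 l1 hz.
have lam0 : levec 0 lam by apply: levec2; rewrite mxE ltW.
have [[Xx _]] := D_argminP lam z lam0 hz.
have [[_ pif] _] := hz; have := levec_dual _ _ Xx pif.
by move=> gy e; apply/esym/(dot_pos_inj lam) => //; rewrite e.
Qed.

(** * Lexicographic minimization over the image *)

Definition lex_minimizes lam mu x :=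
  X x /\ forall x', X x' -> lex_neg (dot lam) (dot mu) (g x - g x').

(** The lexicographic minimum [v] of [s] is a lower bound for the image. The image point [g x]
    componentwise below [v] must equal [v] or precede it, since no nonzero nonnegative direction is
    lexicographically descending. *)
Lemma lex_minimizes_exists lam mu :
  (forall h, levec 0 h -> lex_neg (dot lam) (dot mu) h -> h = 0) ->
  exists x, lex_minimizes lam mu x.
Proof.
move=> rec; have hl := dot_scalar _ _ lam; have hm := dot_scalar _ _ mu.
have lower := s_below _ _ hl hm rec.
have [x0 /lower[v0 v0s _]] := X_neq0.
have [v /s_above[x Xx gxv] hv] := lex_min_seq hl hm _ _ v0s.
exists x; split=> // x' /lower[v' /hv h1 h2].
rewrite -(subrKA v); apply: (lex_negD hl hm); last first.
  by rewrite -(subrKA v'); apply: (lex_negD hl hm).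
have gv : levec 0 (v - g x) by move=> i; rewrite !mxE subr_ge0.
have [/(rec _ gv)/eqP|] := lex_neg_total hl hm (v - g x); last by rewrite opprB.
by rewrite subr_eq0 => /eqP ->; rewrite subrr; exact: lex_neg0.
Qed.

Lemma lex_minimizesW lam mu x : lex_minimizes lam mu x -> minimizes lam x.
Proof.
move=> [Xx h]; split=> // x' /h.
by case=> [|[]]; rewrite (scalar_funB (dot_scalar _ _ _)); lra.
Qed.

(** The common form of [lex_left] and [lex_right], which exchange the two unit weights. *)
Definition lex_solution lam mu (e : R) x :=
  is_opt_value (D_feasible X C c) (D_obj d lam) e /\
  is_argmin [set x | X x /\ dual_value C d c lam x <= e] (dual_value C d c mu) x.

Lemma lex_solutionP lam mu e x : levec 0 lam -> levec 0 mu ->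
  lex_solution lam mu e x -> lex_minimizes lam mu x /\ e = dot lam (g x).
Proof.
move=> l0 m0 [[z hz <-]]; have [[Xz zmin] ze] := D_argminP _ _ l0 hz.
have -> : D_obj d lam z = dot lam (g z.1) by rewrite /D_obj dual_objE.
move=> [[Xx]]; rewrite dual_valueE// => xz xmin.
have ex : dot lam (g x) = dot lam (g z.1) by apply/eqP; rewrite eq_le xz zmin.
split=> //; split=> // x' Xx'; rewrite /lex_neg !(scalar_funB (dot_scalar _ _ _)) ex.
have := zmin x' Xx'; rewrite le_eqVlt => /predU1P[e'|lt']; last by left; lra.
right; split; first lra.
have := xmin x'; rewrite /= !dual_valueE// -e' => /(_ (conj Xx' (lexx _))).
by rewrite subr_le0.
Qed.

Lemma lex_solution_exists lam mu : levec 0 lam -> levec 0 mu ->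
  (forall h, levec 0 h -> lex_neg (dot lam) (dot mu) h -> h = 0) ->
  exists e x, lex_solution lam mu e x.
Proof.
move=> l0 m0 /lex_minimizes_exists[x hx]; have [Xx xmin] := hx.
have [pi hpi] := D_argmin_exists _ _ l0 (lex_minimizesW _ _ _ hx).
exists (dot lam (g x)), x; split.
  exists (x, pi) => //; rewrite /D_obj dual_objE.
  by have [_ ->] := D_argminP _ _ l0 hpi.
split; first by split=> //; rewrite dual_valueE.
move=> x' [Xx']; rewrite !dual_valueE// => le'.
have := xmin x' Xx'; rewrite /lex_neg !(scalar_funB (dot_scalar _ _ _)).
by case=> [|[]]; lra.
Qed.

(** * Supported points and chords *)

(** The weight may have a zero component, so that the two lexicographic starting points qualify;
    nondominatedness is therefore required separately. *)
Definition supported y := [/\ (g @` X) y, forall x, X x -> levec (g x) y -> g x = y &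
  exists w, [/\ levec 0 w, 0 < w 0 0 + w 1 0 &
    forall x, X x -> dot w y <= dot w (g x)]].

Lemma supported_minimizes lam x : 0 < lam 0 0 -> 0 < lam 1 0 ->
  minimizes lam x -> supported (g x).
Proof.
move=> l0 l1 [Xx min]; split; first by exists x.
  by move=> x' Xx' le'; apply: (dot_pos_inj lam) => //; exact: min.
exists lam; split=> //; last lra.
by apply: levec2; rewrite mxE ltW.
Qed.

Lemma supported_nondominated y : supported y -> nondominated X g y.
Proof.
move=> [[x Xx <-] nd _]; exists x => //; split=> // -[x' [Xx' _ [le' ne']]].
by apply: ne'; apply: nd.
Qed.

Lemma supported_eq a b : supported a -> supported b -> a 0 0 = b 0 0 -> a = b.
Proof.
move=> [[xa Xa <-] nda _] [[xb Xb <-] ndb _] e.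
have [h|/ltW h] := leP (g xa 1 0) (g xb 1 0).
  by apply: ndb => //; apply: levec2 => //; rewrite e.
by apply/esym/nda => //; apply: levec2 => //; rewrite e.
Qed.

Definition chord a b := [/\ supported a, supported b, a 0 0 < b 0 0 & b 1 0 < a 1 0].

Lemma chord_weight_pos a b : chord a b ->
  0 < chord_weight a b 0 0 /\ 0 < chord_weight a b 1 0.
Proof. by case=> _ _ h0 h1; rewrite vec2_0 vec2_1 !subr_gt0. Qed.

(** [right_of_supported] is applied at [a], and at [b] with the coordinates exchanged. *)
Lemma below_between a b x : chord a b -> X x -> below a b (g x) ->
  a 0 0 < g x 0 0 /\ b 1 0 < g x 1 0.
Proof.
move=> [[[xa Xa ea] nda [w [w0 w1 wmin]]] [[xb Xb eb] ndb [u [u0 u1 umin]]] ab0 ab1].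
move=> Xx; rewrite belowE => bel.
have := w0 0; have := w0 1; have := u0 0; have := u0 1; rewrite !mxE => *.
have := wmin _ Xb; have := wmin _ Xx; have := umin _ Xa; have := umin _ Xx.
rewrite ea eb !dot2 => *; split.
  apply: (@right_of_supported _ (a 0 0) (a 1 0) (b 0 0) (b 1 0) _ (g x 1 0)
    (w 0 0) (w 1 0)) => // h0 h1.
  by rewrite (nda x)//; apply: levec2.
apply: (@right_of_supported _ (b 1 0) (b 0 0) (a 1 0) (a 0 0) _ (g x 0 0)
  (u 1 0) (u 0 0)) => //; try lra.
by move=> h0 h1; rewrite (ndb x)//; apply: levec2.
Qed.

Definition chord_measure (p : 'cV[R]_2 * 'cV[R]_2) := count (below p.1 p.2) s.

Section Split.
Context {a b : 'cV[R]_2} {x : 'cV[R]_n}.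
Hypothesis ab : chord a b.
Hypothesis x_min : minimizes (chord_weight a b) x.
Hypothesis x_below : below a b (g x).

Lemma chord_split : chord a (g x) /\ chord (g x) b.
Proof.
have [sa sb ab0 ab1] := ab; have [Xx _] := x_min.
have [l0 l1] := chord_weight_pos _ _ ab.
have sx := supported_minimizes _ _ l0 l1 x_min.
have [h0 h1] := below_between _ _ _ ab Xx x_below.
move: x_below; rewrite belowE => bel.
(* The line also passes through [b]: a point below it but higher than [b] is to the left of [b].
   Symmetrically, a point to the right of [a] is lower than [a]. *)
have k0 : 0 < (a 1 0 - b 1 0) * (b 0 0 - g x 0 0).
  have : 0 < (b 0 0 - a 0 0) * (g x 1 0 - b 1 0) by rewrite mulr_gt0 ?subr_gt0.
  lra.
have k1 : 0 < (b 0 0 - a 0 0) * (a 1 0 - g x 1 0).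
  have : 0 < (a 1 0 - b 1 0) * (g x 0 0 - a 0 0) by rewrite mulr_gt0 ?subr_gt0.
  lra.
have x0b : g x 0 0 < b 0 0 by move: k0; rewrite pmulr_rgt0 subr_gt0.
have x1a : g x 1 0 < a 1 0 by move: k1; rewrite pmulr_rgt0 subr_gt0.
by split; split.
Qed.

(** A point of [s] need not be an image point, but some image point is componentwise below it and
    hence also below the chord. *)
Lemma chord_below_s p q v : chord p q -> v \in s -> below p q v ->
  p 0 0 < v 0 0 /\ q 1 0 < v 1 0.
Proof.
move=> pq /s_above[x' Xx' le'] bel.
have [p0 p1] := chord_weight_pos _ _ pq.
have bx : below p q (g x').
  apply: le_lt_trans bel; apply: dot_ge_levec => //.
  by apply: levec2; rewrite mxE ltW.
have [h0 h1] := below_between _ _ _ pq Xx' bx.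
by split; [apply: lt_le_trans h0 _|apply: lt_le_trans h1 _].
Qed.

Lemma below_left v : v \in s -> below a (g x) v -> below a b v.
Proof.
move=> vs bel; have [ax xb] := chord_split.
have [h0 h1] := chord_below_s _ _ _ ax vs bel.
have [_ _ ax0 ax1] := ax; have [_ _ ab0 ab1] := ab.
move: bel x_below; rewrite !belowE => bel xbel.
have := @below_chord_trans _ (a 0 0) (a 1 0) (g x 0 0) (g x 1 0) (v 0 0) (v 1 0)
  (a 1 0 - b 1 0) (b 0 0 - a 0 0) ax0 h0.
by rewrite subr_gt0 => /(_ ab0); lra.
Qed.

Lemma below_right v : v \in s -> below (g x) b v -> below a b v.
Proof.
move=> vs bel; have [ax xb] := chord_split.
have [h0 h1] := chord_below_s _ _ _ xb vs bel.
have [_ _ xb0 xb1] := xb; have [_ _ ab0 ab1] := ab.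
move: bel x_below; rewrite !belowE => bel xbel.
have := @below_chord_trans _ (b 1 0) (b 0 0) (g x 1 0) (g x 0 0) (v 1 0) (v 0 0)
  (b 0 0 - a 0 0) (a 1 0 - b 1 0) xb1 h1.
by rewrite subr_gt0 => /(_ ab1); lra.
Qed.

(* [g x] may lie in the relative interior of an edge of the convex hull; then
   both endpoints of this edge are below the chord, and each of the two new
   chords loses one of them. *)
Lemma edge_point psi : scalar psi ->
  exists2 v, v \in s & dot (chord_weight a b) v = dot (chord_weight a b) (g x) /\
    psi v <= psi (g x).
Proof.
move=> hpsi; have [l0 l1] := chord_weight_pos _ _ ab; have [Xx min] := x_min.
set lam := chord_weight a b in l0 l1 min *.
have [h hh|v vs hv] := s_below _ _ (dot_scalar _ _ lam) hpsi _ x Xx.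
  move=> hneg; apply/esym/(dot_pos_inj lam) => //.
  by rewrite (scalar_fun0 (dot_scalar _ _ lam)); case: hneg => [/ltW//|[->]].
have [x' Xx' le'] := s_above v vs.
have lam0 : levec 0 lam by apply: levec2; rewrite mxE ltW.
have := le_trans (min _ Xx') (dot_ge_levec _ _ _ lam0 le').
exists v => //; move: hv; rewrite /lex_neg (scalar_funB (dot_scalar _ _ lam)).
rewrite (scalar_funB hpsi).
by case=> [|[? ?]]; [lra|split; lra].
Qed.

Lemma chord_measure_left : (chord_measure (a, g x) < chord_measure (a, b))%N.
Proof.
(* This tie-breaker selects a point [v] of [s] on the supporting line, not to the left of [g x]. It
   is below the old chord but not below the chord from [a] to [g x]. *)
have hpsi : scalar (fun y : 'cV[R]_2 => - y 0 0).
  by move=> k u v; rewrite !mxE; lra.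
have [v vs [ev hv]] := edge_point _ hpsi.
apply: (count_lt _ _ _ _ _ below_left vs).
  by rewrite /= /below ev.
have [[_ _ ax0 ax1] _] := chord_split; have [_ _ ab0 ab1] := ab.
move: x_below ev; rewrite /= -leNgt !belowE !dot2 !vec2_0 !vec2_1 => xbel ev.
have := @not_below_chord _ (a 0 0) (a 1 0) (g x 0 0) (g x 1 0) (v 0 0) (v 1 0)
  (a 1 0 - b 1 0) (b 0 0 - a 0 0).
rewrite !subr_gt0; have h : g x 0 0 <= v 0 0 by lra.
by move=> /(_ h ab0); lra.
Qed.

Lemma chord_measure_right : (chord_measure (g x, b) < chord_measure (a, b))%N.
Proof.
have hpsi : scalar (fun y : 'cV[R]_2 => - y 1 0).
  by move=> k u v; rewrite !mxE; lra.
have [v vs [ev hv]] := edge_point _ hpsi.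
apply: (count_lt _ _ _ _ _ below_right vs).
  by rewrite /= /below ev.
have [_ [_ _ xb0 xb1]] := chord_split; have [_ _ ab0 ab1] := ab.
move: x_below ev; rewrite /= -leNgt !belowE !dot2 !vec2_0 !vec2_1 => xbel ev.
have := @not_below_chord _ (b 1 0) (b 0 0) (g x 1 0) (g x 0 0) (v 1 0) (v 0 0)
  (b 0 0 - a 0 0) (a 1 0 - b 1 0).
rewrite !subr_gt0; have h : g x 1 0 <= v 1 0 by lra.
by move=> /(_ h ab1); lra.
Qed.

End Split.

(** * Extreme supported points relative to chords *)

Lemma extreme_above_chord y a b t : extreme_supported X g y ->
  supported a -> supported b -> a <> y -> b <> y -> 0 <= t <= 1 ->
  ~ levec (t *: a + (1 - t) *: b) y.
Proof.
move=> [_ ext] sa sb ay yb /andP[t0 t1] le'; apply: ext.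
exists 2%N, (fun j => if j == 0 then t else 1 - t), (fun j => if j == 0 then a else b).
split.
- by apply: ord2P => /=; split=> //; exact: supported_nondominated.
- by apply: ord2P => //=; rewrite subr_ge0.
- by rewrite sum_ord2 /= addrC subrK.
- by rewrite sum_ord2.
Qed.

Lemma extreme_minimal y z : extreme_supported X g y -> supported z ->
  levec z y -> z = y.
Proof.
move=> ey sz le'; apply: contrapT => zy.
apply: (extreme_above_chord y z z 1 ey) => //; first by rewrite ler01 lexx.
by rewrite scale1r subrr scale0r addr0.
Qed.

Lemma no_extreme_in_discarded y a b : extreme_supported X g y -> chord a b ->
  (forall x, X x -> dot (chord_weight a b) a <= dot (chord_weight a b) (g x)) ->
  ~ (a 0 0 < y 0 0 < b 0 0).
Proof.
move=> ey [sa sb ab0 ab1] min /andP[ay yb].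
have [[x Xx gx] _] := ey; have := min x Xx; rewrite gx !dot2 vec2_0 vec2_1 => h.
(* This weight gives the convex combination of [a] and [b] the same first coordinate as [y]. *)
pose t := (b 0 0 - y 0 0) / (b 0 0 - a 0 0).
have ab0' : 0 < b 0 0 - a 0 0 by rewrite subr_gt0.
have tE : t * (b 0 0 - a 0 0) = b 0 0 - y 0 0 by rewrite /t divfK ?gt_eqF.
apply: (extreme_above_chord y a b t ey sa sb).
- by move=> e; rewrite e ltxx in ay.
- by move=> e; rewrite e ltxx in yb.
- by rewrite /t divr_ge0 ?ler_pdivrMr ?mul1r ?(ltW ab0') //; lra.
apply: levec2; rewrite !mxE; first lra.
have := congr1 (fun r => r * (a 1 0 - b 1 0)) tE; rewrite -(ler_pM2l ab0'); lra.
Qed.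

(** * The lexicographic starting points *)

Lemma vec2_10_ge0 : levec 0 (vec2 1 0 : 'cV[R]_2).
Proof. by apply: levec2; rewrite !mxE. Qed.

Lemma vec2_01_ge0 : levec 0 (vec2 0 1 : 'cV[R]_2).
Proof. by apply: levec2; rewrite !mxE. Qed.

Lemma dot_vec2_10 y : dot (vec2 1 0) y = y 0 0.
Proof. by rewrite dot2 vec2_0 vec2_1 mul1r mul0r addr0. Qed.

Lemma dot_vec2_01 y : dot (vec2 0 1) y = y 1 0.
Proof. by rewrite dot2 vec2_0 vec2_1 mul1r mul0r add0r. Qed.

Lemma lex_left_exists : exists xL yL, lex_left X C d c xL yL.
Proof.
have [h hh|e [xL [h1 h2]]] := lex_solution_exists _ _ vec2_10_ge0 vec2_01_ge0.
  have := hh 0; have := hh 1.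
  rewrite /lex_neg dot_vec2_10 dot_vec2_01 !mxE => ? ? e.
  by apply: cV2_eq; rewrite mxE; case: e => [|[]]; lra.
by exists xL, (vec2 e (dual_value C d c (vec2 0 1) xL)), e; split.
Qed.

Lemma lex_right_exists : exists xR yR, lex_right X C d c xR yR.
Proof.
have [h hh|e [xR [h1 h2]]] := lex_solution_exists _ _ vec2_01_ge0 vec2_10_ge0.
  have := hh 0; have := hh 1.
  rewrite /lex_neg dot_vec2_10 dot_vec2_01 !mxE => ? ? e.
  by apply: cV2_eq; rewrite mxE; case: e => [|[]]; lra.
by exists xR, (vec2 (dual_value C d c (vec2 1 0) xR) e), e; split.
Qed.

Lemma lex_leftP xL yL : lex_left X C d c xL yL ->
  [/\ X xL, g xL = yL, supported yL & forall x, X x ->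
    yL 0 0 <= g x 0 0 /\ (g x 0 0 <= yL 0 0 -> yL 1 0 <= g x 1 0)].
Proof.
move=> [e [h1 h2 ->]].
have [[XL min] ->] := lex_solutionP _ _ _ _ vec2_10_ge0 vec2_01_ge0 (conj h1 h2).
rewrite (dual_valueE _ _ vec2_01_ge0 XL) dot_vec2_10 dot_vec2_01.
have -> : vec2 (g xL 0 0) (g xL 1 0) = g xL by apply: cV2_eq; rewrite ?vec2_0 ?vec2_1.
have {}min x : X x ->
    g xL 0 0 <= g x 0 0 /\ (g x 0 0 <= g xL 0 0 -> g xL 1 0 <= g x 1 0).
  move=> /min; rewrite /lex_neg dot_vec2_10 dot_vec2_01 !mxE.
  by case=> [|[]] *; split; lra.
split=> //; split; first by exists xL.
  move=> x /min[h3 h4] le'; apply: cV2_eq; apply/eqP; rewrite eq_le.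
    by rewrite h3 le'.
  by rewrite h4 ?le'.
exists (vec2 1 0); split; first exact: vec2_10_ge0.
  by rewrite vec2_0 vec2_1 addr0.
by move=> x /min[]; rewrite !dot_vec2_10.
Qed.

Lemma lex_rightP xR yR : lex_right X C d c xR yR ->
  [/\ X xR, g xR = yR, supported yR & forall x, X x ->
    yR 1 0 <= g x 1 0 /\ (g x 1 0 <= yR 1 0 -> yR 0 0 <= g x 0 0)].
Proof.
move=> [e [h1 h2 ->]].
have [[XR min] ->] := lex_solutionP _ _ _ _ vec2_01_ge0 vec2_10_ge0 (conj h1 h2).
rewrite (dual_valueE _ _ vec2_10_ge0 XR) dot_vec2_10 dot_vec2_01.
have -> : vec2 (g xR 0 0) (g xR 1 0) = g xR by apply: cV2_eq; rewrite ?vec2_0 ?vec2_1.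
have {}min x : X x ->
    g xR 1 0 <= g x 1 0 /\ (g x 1 0 <= g xR 1 0 -> g xR 0 0 <= g x 0 0).
  move=> /min; rewrite /lex_neg dot_vec2_10 dot_vec2_01 !mxE.
  by case=> [|[]] *; split; lra.
split=> //; split; first by exists xR.
  move=> x /min[h3 h4] le'; apply: cV2_eq; apply/eqP; rewrite eq_le.
    by rewrite h4 ?le'.
  by rewrite h3 le'.
exists (vec2 0 1); split; first exact: vec2_01_ge0.
  by rewrite vec2_0 vec2_1 add0r.
by move=> x /min[]; rewrite !dot_vec2_01.
Qed.

(** * Invariants, termination and progress of the runs *)

Let E := [set y | extreme_supported X g y].
Let step := da_step X C d c E.

Definition loop_inv (L : seq ('cV[R]_2 * 'cV[R]_2)) (S : seq ('cV[R]_n * 'cV[R]_2)) :=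
  [/\ forall a b, (a, b) \in L -> chord a b,
      forall x y, (x, y) \in S -> X x /\ g x = y
    & forall y, E y -> (exists x, (x, y) \in S) \/
        exists a b, (a, b) \in L /\ a 0 0 < y 0 0 < b 0 0].

Definition state_inv (st : da_state R n) : Prop :=
  match st with
  | Start => True
  | Loop L T => loop_inv L T
  | Returned Xs Ys => representative_set X g Xs /\ Ys = E
  end.

Lemma mem_rem_or (T : eqType) (L : seq T) p q :
  p \in L -> p = q \/ p \in rem q L.
Proof.
have [qL|/rem_id-> ->] := boolP (q \in L); last by right.
by rewrite (perm_mem (perm_to_rem qL)) inE => /predU1P.
Qed.

(** The common point minimizes both coordinates, so it is the ideal point and dominates every other
    image point. *)
Lemma init_single_inv xL yL xR yR :
  lex_left X C d c xL yL -> lex_right X C d c xR yR -> yL = yR ->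
  state_inv (Returned [set xL] [set yL]).
Proof.
move=> /lex_leftP[XL gL sL minL] /lex_rightP[_ _ _ minR] e.
rewrite -e in minR.
have ideal x : X x -> levec yL (g x).
  move=> Xx; have [? _] := minL x Xx; have [? _] := minR x Xx.
  exact: levec2.
have EL : [set yL] = E.
  apply/seteqP; split=> [y ->|y ey]; last first.
    have [[x Xx gx] _] := ey; apply/esym/(extreme_minimal y) => //.
    by rewrite -gx; exact: ideal.
  split; first by exists xL.
  (* Weights summing to 1 cannot form an empty family, so there would be a nondominated point other
     than [yL]. *)
  move=> [N [w [v [hv w0 w1 _]]]]; have [j _] : exists j : 'I_N, true.
    case: N w v hv w0 w1 => [|N] w v _ _; last by exists ord0.
    by rewrite big_ord0 => /eqP; rewrite eq_sym oner_eq0.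
  have [[x [Xx eff] <-] ne] := hv j; apply: eff; exists xL; split=> //.
    by move=> exL; apply: ne; rewrite -exL.
  by rewrite /dominates gL; split; [exact: ideal|exact/nesym].
split=> //; split; first by move=> x ->.
by rewrite -/E -EL image_set1 gL.
Qed.

Lemma init_pair_inv xL yL xR yR :
  lex_left X C d c xL yL -> lex_right X C d c xR yR -> yL <> yR ->
  loop_inv [:: (yL, yR)] [:: (xL, yL); (xR, yR)].
Proof.
move=> /lex_leftP[XL gL sL minL] /lex_rightP[XR gR sR minR] ne.
have [l0 l1] := minL _ XR; have [r1 r0] := minR _ XL.
rewrite gR in l0 l1; rewrite gL in r1 r0.
have LR0 : yL 0 0 < yR 0 0.
  rewrite lt_neqAle l0 andbT; apply/eqP => e; apply: ne; exact: supported_eq.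
have LR1 : yR 1 0 < yL 1 0.
  rewrite lt_neqAle r1 andbT; apply/eqP => e; move: LR0.
  by rewrite ltNge r0 ?e.
split.
- by move=> a b; rewrite inE => /eqP[-> ->]; split.
- by move=> x y; rewrite !inE => /orP[]/eqP[-> ->].
move=> y ey; have [[x Xx gx] _] := ey.
have [m0 m1] := minL x Xx; have [m2 m3] := minR x Xx; rewrite gx in m0 m1 m2 m3.
(* Outside the open interval one of the starting points is componentwise below [y], and extremality
   makes them equal. *)
have [h0|h0] := leP (y 0 0) (yL 0 0).
  left; exists xL; rewrite -(extreme_minimal y yL) ?mem_head//.
  by apply: levec2 => //; exact: m1.
have [h1|h1] := leP (yR 0 0) (y 0 0).
  left; exists xR; rewrite -(extreme_minimal y yR) ?inE ?eqxx ?orbT//.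
  exact: levec2.
by right; exists yL, yR; rewrite mem_head h0 h1.
Qed.

Lemma split_point a b xs pis : chord a b ->
  is_argmin (D_feasible X C c) (D_obj d (chord_weight a b)) (xs, pis) ->
  \col_i dot d (pis i) = g xs /\ minimizes (chord_weight a b) xs.
Proof.
move=> ab hmin; have [l0 l1] := chord_weight_pos _ _ ab.
have lam0 : levec 0 (chord_weight a b) by apply: levec2; rewrite mxE ltW.
have [h _] := D_argminP _ _ lam0 hmin.
by have := D_argmin_pos _ _ l0 l1 hmin.
Qed.

Lemma split_below a b xs : chord a b -> minimizes (chord_weight a b) xs ->
  dot (chord_weight a b) (g xs) <> dot (chord_weight a b) a -> below a b (g xs).
Proof.
move=> [[[xa Xa <-] _ _] _ _ _] [_ min] /eqP ne.
by rewrite /below lt_neqAle ne min.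
Qed.

Lemma loop_split_inv L S a b x : loop_inv L S -> (a, b) \in L ->
  minimizes (chord_weight a b) x -> below a b (g x) ->
  loop_inv ((a, g x) :: (g x, b) :: rem (a, b) L) ((x, g x) :: S).
Proof.
move=> [hL hS hE] abL xmin xbel; have ab := hL _ _ abL.
have [ax xb] := chord_split ab xmin xbel.
have [Xx _] := xmin.
split.
- move=> a' b'; rewrite !inE => /predU1P[[-> ->]//|/predU1P[[-> ->]//|]].
  by move=> /mem_rem/hL.
- by move=> x' y'; rewrite !inE => /predU1P[[-> ->]//|/hS].
move=> y ey; have [[x' x'S]|[a' [b' [abL' bt]]]] := hE y ey.
  by left; exists x'; rewrite inE x'S orbT.
have [e|h] := mem_rem_or _ _ _ (a, b) abL'; last first.
  by right; exists a', b'; rewrite !inE h !orbT.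
case: e bt => -> -> /andP[h0 h1].
have [h|h|h] := ltgtP (y 0 0) (g x 0 0).
- by right; exists a, (g x); rewrite mem_head h0 h.
- by right; exists (g x), b; rewrite !inE eqxx orbT h h1.
(* With equal first coordinates, one of [y] and [g x] is componentwise below the other; either
   extremality of [y] or nondominatedness of [g x] identifies them. *)
left; exists x; have [sx _ _ _] := xb.
suff -> : y = g x by rewrite mem_head.
have [[z Xz gz] _] := ey.
have [h2|/ltW h2] := leP (g x 1 0) (y 1 0).
  by apply/esym/(extreme_minimal y) => //; apply: levec2; rewrite ?h.
have [_ nd _] := sx; rewrite -gz; apply: nd => //; rewrite gz.
by apply: levec2; rewrite ?h.
Qed.

Lemma loop_discard_inv L S a b : loop_inv L S -> (a, b) \in L ->
  (forall x, X x -> dot (chord_weight a b) a <= dot (chord_weight a b) (g x)) ->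
  loop_inv (rem (a, b) L) S.
Proof.
move=> [hL hS hE] abL min; split=> //; first by move=> a' b' /mem_rem/hL.
move=> y ey; have [|[a' [b' [abL' bt]]]] := hE y ey; first by left.
have [e|h] := mem_rem_or _ _ _ (a, b) abL'; last by right; exists a', b'.
case: e bt => -> -> bt.
by have := no_extreme_in_discarded y a b ey (hL _ _ abL) min.
Qed.

Lemma finish_inv S : loop_inv [::] S ->
  state_inv (Returned [set x | exists2 y, (x, y) \in S & E y]
                      [set y | exists2 x, (x, y) \in S & E y]).
Proof.
move=> [_ hS hE].
have mem_S y : E y -> exists x, (x, y) \in S.
  by move=> /hE[//|[a [b []]]]; rewrite in_nil.
split; last first.
  by apply/seteqP; split=> [y [x _ ]//|y ey]; have [x xS] := mem_S y ey; exists x.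
split; first by move=> x [y /hS[]].
apply/seteqP; split=> [_ [x [y /hS[_ <-] ey] <-]//|y ey].
by have [x xS] := mem_S y ey; exists x; [exists y|have [] := hS _ _ xS].
Qed.

Lemma step_inv st st' : state_inv st -> step st st' -> state_inv st'.
Proof.
move=> inv h; case: h inv => [xL yL xR yR hL hR e _|xL yL xR yR hL hR e _|
  L S a b xs pis ys abL hmin -> ne inv|L S a b xs pis ys abL hmin -> e inv|S inv].
- exact: init_single_inv hL hR e.
- exact: init_pair_inv.
- have ab : chord a b by have [/(_ _ _ abL)] := inv.
  have [ge xmin] := split_point _ _ _ _ ab hmin; rewrite ge in ne *.
  by apply: loop_split_inv => //; exact: split_below.
- have ab : chord a b by have [/(_ _ _ abL)] := inv.
  have [ge [_ min]] := split_point _ _ _ _ ab hmin; rewrite ge in e.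
  by apply: loop_discard_inv => //; rewrite -e.
- exact: finish_inv.
Qed.

Lemma reachable_inv st st' : clos_refl_trans _ step st st' ->
  state_inv st -> state_inv st'.
Proof.
by elim=> [? ? /step_inv h /h//|//|x y z _ h1 _ h2 /h1/h2].
Qed.

(* Base 3, since a split replaces a chord by two chords of smaller measure. *)
Definition loop_measure (L : seq ('cV[R]_2 * 'cV[R]_2)) : nat :=
  (\sum_(p <- L) 3 ^ chord_measure p)%N.

Lemma loop_measure_rem L p : p \in L ->
  loop_measure L = (3 ^ chord_measure p + loop_measure (rem p L))%N.
Proof. by move=> pL; rewrite /loop_measure (big_rem p). Qed.

Lemma acc_returned Xs Ys : Acc (fun s' s => step s s') (Returned Xs Ys).
Proof. by constructor => st h; inversion h. Qed.

Lemma acc_loop L S : loop_inv L S -> Acc (fun s' s => step s s') (Loop L S).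
Proof.
have [N] := ubnP (loop_measure L); elim: N L S => [L S|N IH L S ltN inv].
  by rewrite ltn0.
constructor => st h; have := step_inv (Loop L S) st inv h.
inversion h as [| |L' S' a b xs pis ys abL hmin eys ne|
  L' S' a b xs pis ys abL hmin eys e|]; subst => inv'; last exact: acc_returned.
- have ab : chord a b by have [/(_ _ _ abL)] := inv.
  have [ge xmin] := split_point _ _ _ _ ab hmin; rewrite ge in ne inv' *.
  have xbel := split_below _ _ _ ab xmin ne.
  apply: IH inv'; apply: leq_trans (ltnSE ltN); rewrite (loop_measure_rem _ _ abL).
  rewrite /loop_measure !big_cons addnA ltn_add2r.
  have := chord_measure_left ab xmin xbel; have := chord_measure_right ab xmin xbel.
  case: (chord_measure (a, b)) => // k; rewrite !ltnS => lr ll.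
  have el : (3 ^ chord_measure (a, g xs) <= 3 ^ k)%N by rewrite leq_pexp2l.
  have er : (3 ^ chord_measure (g xs, b) <= 3 ^ k)%N by rewrite leq_pexp2l.
  have e0 : (0 < 3 ^ k)%N by rewrite expn_gt0.
  apply: leq_ltn_trans (leq_add el er) _.
  by rewrite expnS addnn -mul2n ltn_pmul2r.
- apply: IH inv'; apply: leq_trans (ltnSE ltN); rewrite (loop_measure_rem _ _ abL).
  by rewrite -[X in (X < _)%N]add0n ltn_add2r expn_gt0.
Qed.

Lemma acc_start : Acc (fun s' s => step s s') Start.
Proof.
constructor => st h; have := step_inv Start st I h.
case: st h => [|L S|Xs Ys] h inv; first by inversion h.
  exact: acc_loop.
exact: acc_returned.
Qed.

Lemma progress st : state_inv st -> ~ is_returned st -> exists st', step st st'.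
Proof.
case: st => [|[|[a b] L] S|Xs Ys].
- move=> _ _; have [xL [yL hL]] := lex_left_exists.
  have [xR [yR hR]] := lex_right_exists.
  have [e|ne] := pselect (yL = yR).
    by exists (Returned [set xL] [set yL]); exact: da_init_single hL hR e.
  by exists (Loop [:: (yL, yR)] [:: (xL, yL); (xR, yR)]); exact: da_init_pair.
- by move=> _ _; eexists; exact: da_finish.
- move=> [hL _ _] _; have abL : (a, b) \in (a, b) :: L by exact: mem_head.
  have ab := hL _ _ abL; have [l0 l1] := chord_weight_pos _ _ ab.
  (* No tie-breaker is necessary: a positive weight already excludes nonzero nonnegative descent
     directions. *)
  have [h hh hneg|x hx] := lex_minimizes_exists (chord_weight a b) 0.
    apply/esym/(dot_pos_inj (chord_weight a b)) => //.
    rewrite (scalar_fun0 (dot_scalar _ _ _)).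
    by case: hneg => [/ltW//|[->]].
  have lam0 : levec 0 (chord_weight a b) by apply: levec2; rewrite mxE ltW.
  have [pi hpi] := D_argmin_exists _ _ lam0 (lex_minimizesW _ _ _ hx).
  have [e|ne] := pselect (dot (chord_weight a b) (\col_i dot d (pi i)) =
    dot (chord_weight a b) a).
    by exists (Loop (rem (a, b) ((a, b) :: L)) S); exact: da_discard hpi _ e.
  by eexists; exact: da_split hpi erefl ne.
by move=> _ []; exists Xs, Ys.
Qed.

Lemma da_correct : da_solves X C d c g.
Proof.
split; first exact: acc_start.
  by move=> st /reachable_inv/(_ I); exact: progress.
by move=> Xs Ys /reachable_inv/(_ I).
Qed.

End DualizationApproach.

(** * The robust objectives as maxima over vertices *)

Lemma sup_max (R : realType) (A : set R) (a : R) :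
  A a -> (forall b, A b -> b <= a) -> sup A = a.
Proof.
move=> Aa amax; apply/eqP; rewrite eq_le ge_sup//=; last by exists a.
by apply: ub_le_sup => //; exists a.
Qed.

Lemma robust_objP (R : realType) (n m : nat) (U : set 'cV[R]_m)
    (f : 'I_2 -> 'cV[R]_n -> 'cV[R]_m -> R) x i v :
  U v -> (forall xi, U xi -> f i x xi <= f i x v) ->
  robust_obj U f x i 0 = f i x v.
Proof.
move=> Uv vmax; rewrite mxE; apply: sup_max; first by exists v.
by move=> _ [xi Uxi <-]; exact: vmax.
Qed.

Theorem lemma21 (R : realType) (n m m' : nat)
    (X : set 'cV[R]_n) (U : set 'cV[R]_m)
    (C : 'M[R]_(m', m)) (d : 'cV[R]_m')
    (f : 'I_2 -> 'cV[R]_n -> 'cV[R]_m -> R)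
    (c : 'I_2 -> 'cV[R]_n -> 'cV[R]_m)
    (hX : BRO1 X)
    (hf : BRO3 X U f)
    (hUC : U = polyhedron C d)
    (hU0 : U !=set0)
    (hU : is_polytope U)
    (hbil : forall i, bilinear_on X U (f i))
    (hc : forall i x xi, X x -> U xi -> f i x xi = dot (c i x) xi) :
  da_solves X C d c (robust_obj U f).
Proof.
have [X0 [k [P [_ [[q [A [b PE]]] Pb] XE]]]] := hX.
have [_ Ub] := hU; rewrite hUC in Ub hU0.
have [B [BU Bmax]] := polytope_vertices _ _ _ _ _ hU0 Ub.
rewrite -hUC in hU0.
have vertex x i : X x -> exists2 v, v \in B &
    robust_obj U f x i 0 = f i x v /\ forall xi, U xi -> f i x xi <= f i x v.
  move=> Xx; have [v vB vmax] := Bmax (c i x); exists v => //.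
  have Uv : U v by rewrite hUC; exact: BU.
  have max xi : U xi -> f i x xi <= f i x v.
    by move=> Uxi; rewrite !hc//; apply: vmax; rewrite -hUC.
  by split=> //; exact: robust_objP.
have obj_ge x i xi : X x -> U xi -> dot (c i x) xi <= robust_obj U f x i 0.
  by move=> Xx Uxi; have [v _ [-> max]] := vertex x i Xx; rewrite -hc// max.
have [u0 u0B] : exists u, u \in B by have [v vB _] := Bmax 0; exists v.
(* For each vertex of [U], bilinearity provides a linear form on the whole space that agrees with
   the objective on [X]. The robust objectives are the maxima of these forms. *)
have /choice[l hl] : forall iu : 'I_2 * seq_sub B,
    exists h : {scalar 'cV[R]_n}, forall x, X x -> f iu.1 x (ssval iu.2) = h x.
  by move=> [i u]; have [h _] := hbil i; apply: h; rewrite hUC; apply/BU/ssvalP.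
have [|||x Xx i|s [sX slow]] := @finite_image_vertices R n k q (seq_sub B)
    (SeqSub u0B) A b (fun i u => l (i, u)) (robust_obj U f).
- by rewrite -PE -XE.
- by rewrite -PE.
- by move=> i u t x y; rewrite linearP.
- have {}Xx : X x by rewrite XE PE.
  have [v vB [-> max]] := vertex x i Xx; split=> [u|].
    by rewrite -(hl (i, u))//=; apply: max; rewrite hUC; apply/BU/ssvalP.
  by exists (SeqSub vB); rewrite -(hl (i, SeqSub vB)).
rewrite -PE -XE in sX slow.
apply: (da_correct X C d c _ s) => //.
- move=> x i Xx; apply: lp_strong_duality; rewrite -hUC// => xi.
  exact: obj_ge.
- move=> x i pi Xx Cpi pi0; have [v vB [-> _]] := vertex x i Xx.
  by rewrite hc//; [apply: lp_weak_duality (BU v vB) _ _|rewrite hUC; exact: BU].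
Qed.
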